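(* Let $(X,\operatorname{Lim})$ be a $\operatorname{Lim}$-space, let $\mathfrak{C}\subset s(X)$ be a Cauchy structure, and suppose that $(X,\operatorname{Lim})$ is $\mathfrak{C}$-complete. Let $f\colon X\to X$ be a weakly orbital continuous mapping which is locally orbital contractive (with respect to $\mathfrak{C}$) at some point $x_0\in X$. Then: (1) $f$ has a fixed set, i.e. there is a non-empty set $A\subset X$ with $f(A)=A$. (2) If $\mathfrak{C}$ is a Strong Cauchy structure, the space $(X,\operatorname{Lim})$ is a $\mathfrak{C}$-Fréchet space, and $O(f,x_0)\in\mathfrak{C}$, then $f$ has a fixed point, i.e. there is $x\in X$ with $f(x)=x$. (3) If, in addition to the assumptions of (2), for any $x,y\in X$ the interleaved sequence $\{f^n(x)\}\vee\!\wedge\{f^n(y)\}$ belongs to $\mathfrak{C}$, then the fixed point of $f$ is unique.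
   Context: $X$ is a non-empty set, $s(X)$ is the set of all sequences of elements of $X$, $s^\infty(X)$ is the set of sequences in $s(X)$ with pairwise different elements, and $\mathcal{P}(X)$ is the power set of $X$. For $x_1,\ldots,x_n\in X$, $\langle x_1,\ldots,x_n\rangle$ denotes the periodic sequence $\{x_1,\ldots,x_n,x_1,\ldots,x_n,\ldots\}$. For $\{x_n\},\{y_n\}\in s(X)$, the interleaved sequence is $\{x_n\}\vee\!\wedge\{y_n\}:=\{x_1,y_1,x_2,y_2,\ldots,x_n,y_n,\ldots\}$. For $f\colon X\to X$ and $x\in X$, the orbit is the sequence $O(f,x)=\{f^n(x)\}=\{x,f(x),f^2(x),\ldots\}$ (starting with $f^0(x)=x$), and $O(f)=\{O(f,x)\colon x\in X\}\subset s(X)$. A $\operatorname{Lim}$-space is a pair $(X,\operatorname{Lim})$ with $\operatorname{Lim}\colon s(X)\to\mathcal{P}(X)$ such that $\operatorname{Lim}\{x_n\}=\operatorname{Lim}\{x_{n+1}\}$ for every $\{x_n\}\in s(X)$, where $\{x_{n+1}\}=\{x_2,x_3,\ldots\}$. A sequence $\{x_n\}$ is convergent, written $\{x_n\}\in c(X)$, if $\operatorname{Lim}\{x_n\}\ne\emptyset$. For a set $\mathfrak{A}$ of sequences in $X$, $(X,\operatorname{Lim})$ is an $\mathfrak{A}$-Fréchet space if $\operatorname{Lim}\{x_n\}$ is a singleton for each $\{x_n\}\in c(X)\cap\mathfrak{A}$. A mapping $f\colon X\to X$ is weakly orbital continuous if $\operatorname{Lim}\{f(x_n)\}=f(\operatorname{Lim}\{x_n\})$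 for every $\{x_n\}\in O(f)\cap c(X)$ (the right side being the image of a set under $f$). A set $\mathfrak{C}\subset s(X)$ is a Cauchy structure if $\{x_n\}\in\mathfrak{C}$ implies $\{x_{n+1}\}\in\mathfrak{C}$. It is a Strong Cauchy structure if additionally $\langle x\rangle\in\mathfrak{C}$ for each $x\in X$ and, for any $n$ and any $z_1,\ldots,z_n\in X$, $\langle z_1,\ldots,z_n\rangle\in\mathfrak{C}$ implies $z_1=z_n$. $(X,\operatorname{Lim})$ is $\mathfrak{C}$-complete if every $\{x_n\}\in\mathfrak{C}\cap s^\infty(X)$ is convergent. $f$ is locally orbital contractive at $x_0\in X$ if $O(f,x_0)\in(\mathfrak{C}\cap s^\infty(X))\cup(s(X)\setminus s^\infty(X))$. A fixed set of $f$ is a set $A\subset X$ with $f(A)=A$ (here required to be non-empty); $x$ is a fixed point if $\{x\}$ is a fixed set. *)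

(* Defs.v *)
From mathcomp Require Import all_boot.
From mathcomp Require Import all_classical.

Set Implicit Arguments.
Unset Strict Implicit.
Unset Printing Implicit Defensive.

Local Open Scope classical_set_scope.

(* Sequences in X are functions nat -> X indexed from 0: u k is the usual
   term x_(k+1). *)

Definition shift_seq (X : Type) (u : nat -> X) : nat -> X := fun k => u k.+1.

Definition inj_seqs (X : Type) : set (nat -> X) := [set u | injective u].

(* <z_1, ..., z_m> for m >= 1, with m = n.+1 and z_i = z (i - 1). *)
Definition periodic_seq (X : Type) (n : nat) (z : 'I_n.+1 -> X) : nat -> X :=
  fun k => z (inord (k %% n.+1)).

Definition interleave (X : Type) (u v : nat -> X) : nat -> X :=
  fun k => if odd k then v k./2 else u k./2.

Definition orbit_seq (X : Type) (f : X -> X) (x : X) : nat -> X :=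
  fun k => iter k f x.

Definition orbits (X : Type) (f : X -> X) : set (nat -> X) :=
  range (orbit_seq f).

Definition lim_space (X : Type) (Lim : (nat -> X) -> set X) : Prop :=
  forall u : nat -> X, Lim u = Lim (shift_seq u).

Definition convergent_seqs (X : Type) (Lim : (nat -> X) -> set X) :
    set (nat -> X) :=
  [set u | Lim u !=set0].

Definition frechet_space (X : Type) (Lim : (nat -> X) -> set X)
    (A : set (nat -> X)) : Prop :=
  forall u, (convergent_seqs Lim `&` A) u -> exists l : X, Lim u = [set l].

Definition weakly_orbital_continuous (X : Type) (Lim : (nat -> X) -> set X)
    (f : X -> X) : Prop :=
  forall u, (orbits f `&` convergent_seqs Lim) u ->
    Lim (fun k => f (u k)) = f @` Lim u.

Definition cauchy_structure (X : Type) (C : set (nat -> X)) : Prop :=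
  forall u, C u -> C (shift_seq u).

Definition strong_cauchy_structure (X : Type) (C : set (nat -> X)) : Prop :=
  [/\ cauchy_structure C,
      forall x : X, C (periodic_seq (fun _ : 'I_1 => x))
    & forall (n : nat) (z : 'I_n.+1 -> X),
        C (periodic_seq z) -> z ord0 = z ord_max].

Definition complete_space (X : Type) (Lim : (nat -> X) -> set X)
    (C : set (nat -> X)) : Prop :=
  C `&` @inj_seqs X `<=` convergent_seqs Lim.

Definition locally_orbital_contractive (X : Type) (C : set (nat -> X))
    (f : X -> X) (x0 : X) : Prop :=
  ((C `&` @inj_seqs X) `|` (setT `\` @inj_seqs X)) (orbit_seq f x0).

Definition fixed_set (X : Type) (f : X -> X) (A : set X) : Prop :=
  A !=set0 /\ f @` A = A.

Definition fixed_point (X : Type) (f : X -> X) (x : X) : Prop :=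
  fixed_set f [set x].

Lemma fixed_pointE (X : Type) (f : X -> X) (x : X) :
  fixed_point f x <-> f x = x.
Proof.
rewrite /fixed_point /fixed_set image_set1; split=> [[_ fx]|->].
  by have : [set f x] (f x) by []; rewrite fx.
by split=> //; exists x.
Qed.

(* Main.v *)
(** If the orbit of x0 has no repetitions, it converges, and weak orbital
    continuity together with shift invariance of Lim makes its limit set a
    fixed set, a singleton in the Frechet case. Otherwise the orbit runs into a
    cycle, which is a fixed set; the periodic tail of the orbit is then a Cauchy
    sequence, so the strong Cauchy axiom identifies the last point of the cycle
    with the first one, which is therefore fixed. Interleaving the constant
    orbits of two fixed points x and y gives the sequence <x, y>, so x = y. *)

Require Import Defs.
From mathcomp Require Import all_boot.
From mathcomp Require Import all_classical.

Local Open Scope classical_set_scope.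

Lemma shift_orbit_seq (X : Type) (f : X -> X) (x : X) :
  shift_seq (orbit_seq f x) = orbit_seq f (f x).
Proof. by apply/funext => k; rewrite /shift_seq /orbit_seq iterSr. Qed.

(** A tail of an orbit is itself the orbit of a later point, so closure of [C] under shifts carries
    over to it. *)
Lemma cauchy_orbit_iter (X : Type) (C : set (nat -> X)) (f : X -> X) (x : X)
    (i : nat) :
  cauchy_structure C -> C (orbit_seq f x) -> C (orbit_seq f (iter i f x)).
Proof.
move=> hC; elim: i => // i IHi /IHi /hC.
by rewrite shift_orbit_seq.
Qed.

Lemma iter_mod_period (X : Type) (f : X -> X) (y : X) (p k : nat) :
  iter p f y = y -> iter (k %% p) f y = iter k f y.
Proof.
move=> fpy; rewrite {2}(divn_eq k p) addnC iterD; congr iter.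
by elim: (k %/ p) => //= q IHq; rewrite mulSn iterD -IHq.
Qed.

Lemma orbit_periodic_seq (X : Type) (f : X -> X) (y : X) (n : nat) :
  iter n.+1 f y = y ->
  orbit_seq f y = periodic_seq (fun i : 'I_n.+1 => iter i f y).
Proof.
move=> fny; apply/funext => k.
by rewrite /periodic_seq inordK ?ltn_pmod // iter_mod_period.
Qed.

Lemma not_inj_orbit (X : Type) (f : X -> X) (x : X) :
  ~ injective (orbit_seq f x) ->
  exists i n, iter n.+1 f (iter i f x) = iter i f x.
Proof.
move=> ninj; apply: contrapT => nocycle; apply: ninj.
have lt_neq (i j : nat) : i < j -> orbit_seq f x i <> orbit_seq f x j.
  (* A repetition at [i < j] closes a cycle of length [j - i] through the [i]-th point; the
     predecessor puts that length in the form [n.+1]. *)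
  move=> lt_ij eq_ij; apply: nocycle; exists i, (j - i).-1.
  by rewrite prednK ?subn_gt0 // -iterD subnK ?(ltnW lt_ij).
move=> i j eq_ij; case: (ltngtP i j) => // [/lt_neq|/lt_neq]; first by [].
by move/(_ (esym eq_ij)).
Qed.

Lemma cycle_fixed_set (X : Type) (f : X -> X) (y : X) (n : nat) :
  iter n.+1 f y = y -> fixed_set f (range (orbit_seq f y)).
Proof.
move=> fny; split; first by exists y, 0.
apply/seteqP; split=> [_ [_ [k _ <-] <-]|_ [k _ <-]]; first by exists k.+1.
(* Going on [n] steps from the [k]-th point, one short of a full turn, reaches a preimage of it. *)
exists (iter (k + n) f y); first by exists (k + n).
by rewrite -iterS -addnS iterD fny.
Qed.

Lemma lim_orbit_fixed_set (X : Type) (Lim : (nat -> X) -> set X)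
    (f : X -> X) (x : X) :
  lim_space Lim -> weakly_orbital_continuous Lim f ->
  convergent_seqs Lim (orbit_seq f x) -> fixed_set f (Lim (orbit_seq f x)).
Proof.
move=> hLim hcont cvg_x; split=> //.
(* Applying [f] termwise to an orbit gives, by computation, the shifted orbit. *)
rewrite -(hcont (orbit_seq f x)); first exact/esym/hLim.
by split=> //; exists x.
Qed.

Lemma strong_cauchy_cycle_fixed_point (X : Type) (C : set (nat -> X))
    (f : X -> X) (y : X) (n : nat) :
  strong_cauchy_structure C -> C (orbit_seq f y) -> iter n.+1 f y = y ->
  f y = y.
Proof.
move=> [_ _ hper] + fny; rewrite (orbit_periodic_seq _ _ _ _ fny) => /hper /= eqy.
(* Since [y] equals the last point [iter n f y], its image is [iter n.+1 f y], that is, [y]. *)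
by rewrite {1}eqy -iterS.
Qed.

Lemma interleave_orbit_fixed_points (X : Type) (f : X -> X) (x y : X) :
  f x = x -> f y = y ->
  interleave (orbit_seq f x) (orbit_seq f y) =
  periodic_seq (fun i : 'I_2 => if odd i then y else x).
Proof.
move=> fx fy; apply/funext => k.
rewrite /interleave /periodic_seq /orbit_seq !iter_fix //.
by rewrite inordK ?ltn_pmod // modn2 oddb.
Qed.

Theorem theorem3p1 (X : Type) (Lim : (nat -> X) -> set X)
    (C : set (nat -> X)) (f : X -> X) (x0 : X)
    (hLim : lim_space Lim)
    (hC : cauchy_structure C)
    (hcomplete : complete_space Lim C)
    (hcont : weakly_orbital_continuous Lim f)
    (hcontr : locally_orbital_contractive C f x0) :
  [/\ exists A : set X, fixed_set f A,
      strong_cauchy_structure C -> frechet_space Lim C ->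
        C (orbit_seq f x0) -> exists x : X, fixed_point f x
    & strong_cauchy_structure C -> frechet_space Lim C ->
        C (orbit_seq f x0) ->
        (forall x y : X, C (interleave (orbit_seq f x) (orbit_seq f y))) ->
        exists! x : X, fixed_point f x].
Proof.
have fixpt : strong_cauchy_structure C -> frechet_space Lim C ->
    C (orbit_seq f x0) -> exists x : X, fixed_point f x.
  move=> hS hF hO; case: hcontr => [CI|[_ ninj]].
    have cvg_x0 := hcomplete _ CI.
    have [l Liml] := hF _ (conj cvg_x0 hO).
    (* A fixed point is by definition a singleton fixed set, and here the limit set is [[set l]]. *)
    by exists l; rewrite /fixed_point -Liml; exact: lim_orbit_fixed_set.
  have [i [n cyc]] := not_inj_orbit _ _ _ ninj.
  exists (iter i f x0); apply/fixed_pointE.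
  apply: (strong_cauchy_cycle_fixed_point _ _ _ _ n hS) => //.
  exact: cauchy_orbit_iter.
split=> //.
  case: hcontr => [/hcomplete cvg_x0|[_ ninj]].
    by exists (Lim (orbit_seq f x0)); exact: lim_orbit_fixed_set.
  have [i [n cyc]] := not_inj_orbit _ _ _ ninj.
  by exists (range (orbit_seq f (iter i f x0))); exact: (cycle_fixed_set _ _ _ n).
move=> hS hF hO hint; have [x fixx] := fixpt hS hF hO.
exists x; split=> // y /fixed_pointE fy; move/fixed_pointE: fixx => fx.
(* In ['I_2] the indices [ord0] and [ord_max] carry [x] and [y]. *)
have := hint x y; rewrite interleave_orbit_fixed_points //.
by case: hS => _ _ hper /hper.
Qed.
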